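(* Let $n\ge1$ and let $\mathcal{G}=(G,[\ ],\oplus_1,\ldots,\oplus_n)$ be a Menger $(2,n)$-semigroup. Then $\mathcal{G}$ is isomorphic to a Menger $(2,n)$-semigroup of (partial) $n$-place functions if and only if it satisfies the following three identities (for all $i=1,\ldots,n$ and all elements of $G$): $$[x\oplus_i y,z_1,\ldots,z_n]=[x,z_1,\ldots,z_{i-1},[y,z_1,\ldots,z_n],z_{i+1},\ldots,z_n],$$ $$[x,y_1,\ldots,y_n]\oplus_i z=[x,\,y_1\oplus_i z,\ldots,y_n\oplus_i z],$$ $$x\oplus_{i_1}y_1\oplus_{i_2}\cdots\oplus_{i_s}y_s=[x,\ \mu_1(\oplus_{i_1}y_1\cdots\oplus_{i_s}y_s),\ldots,\mu_n(\oplus_{i_1}y_1\cdots\oplus_{i_s}y_s)]\quad\text{whenever }\{i_1,\ldots,i_s\}=\{1,\ldots,n\},$$ and the implication $$\bigwedge_{i=1}^n\Big(\mu_i(\oplus_{i_1}x_1\cdots\oplus_{i_s}x_s)=\mu_i(\oplus_{j_1}y_1\cdots\oplus_{j_k}y_k)\Big)\ \Longrightarrow\ g\oplus_{i_1}x_1\cdots\oplus_{i_s}x_s=g\oplus_{j_1}y_1\cdots\oplus_{j_k}y_k$$ for all $g,x_1,\ldots,x_s,y_1,\ldots,y_k\in G$ and all $i_1,\ldots,i_s,j_1,\ldots,j_k\in\{1,\ldots,n\}$.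
   Context: A Menger $(2,n)$-semigroup $(G,[\ ],\oplus_1,\ldots,\oplus_n)$ is a set $G$ with associative binary operations $\oplus_1,\ldots,\oplus_n$ and an $(n+1)$-ary operation $[\ ]$ that is superassociative: $[[x,y_1,\ldots,y_n],z_1,\ldots,z_n]=[x,[y_1,z_1,\ldots,z_n],\ldots,[y_n,z_1,\ldots,z_n]]$. For a set $A$, an $n$-place function on $A$ is a partial map $A^n\to A$. On such functions define $[f,g_1,\ldots,g_n](\bar a)=f(g_1(\bar a),\ldots,g_n(\bar a))$ and $(f\oplus_i g)(\bar a)=f(a_1,\ldots,a_{i-1},g(\bar a),a_{i+1},\ldots,a_n)$ for $\bar a=(a_1,\ldots,a_n)$, where both sides are defined or undefined simultaneously. A Menger $(2,n)$-semigroup of $n$-place functions is a set $\Phi$ of $n$-place functions on some set $A$, closed under these operations, with these operations. Isomorphisms are bijections preserving all operations. Iterated binary products are bracketed to the left: $x\oplus_{i_1}y_1\oplus_{i_2}\cdots\oplus_{i_s}y_s=(\cdots((x\oplus_{i_1}y_1)\oplus_{i_2}y_2)\cdots)\oplus_{i_s}y_s$. For a formal string $\oplus_{i_1}x_1\cdots\oplus_{i_s}x_s$ ($x_j\in G$, $i_j\in\{1,\ldots,n\}$), the symbol $\mu_i(\oplus_{i_1}x_1\cdots\oplus_{i_s}x_s)$ denotes the element $x_k\oplus_{i_{k+1}}x_{k+1}\oplus_{i_{k+2}}\cdots\oplus_{i_s}x_s$ of $G$ if $i=i_k$ and $i\ne i_p$ for all $p<k\le s$ (i.e. $k$ is the first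 position with $i_k=i$); if $i\notin\{i_1,\ldots,i_s\}$ the symbol is empty. For example $\mu_1(\oplus_2x\oplus_1y\oplus_3z)=y\oplus_3z$, $\mu_2(\oplus_2x\oplus_1y\oplus_3z)=x\oplus_1y\oplus_3z$, $\mu_3(\oplus_2x\oplus_1y\oplus_3z)=z$, and $\mu_4(\oplus_2x\oplus_1y\oplus_3z)$ is empty. An equality of two $\mu_i$-symbols means that both are empty, or both are non-empty and equal as elements of $G$. *)

(* Defs.v *)
From mathcomp Require Import all_boot.
From mathcomp Require Import boolp classical_sets.

Set Implicit Arguments.
Unset Strict Implicit.
Unset Printing Implicit Defensive.

Local Open Scope classical_set_scope.

Definition tset (T : Type) (n : nat) (a : n.-tuple T) (i : 'I_n) (b : T) :
    n.-tuple T :=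
  [tuple if j == i then b else tnth a j | j < n].

(* [pmap id] drops the [None]s, and [insub] succeeds only if [n] entries
   remain; hence the result is [Some] exactly when all entries are. *)
Definition all_some (T : Type) (n : nat) (v : n.-tuple (option T)) :
    option (n.-tuple T) :=
  insub (pmap id v).

Lemma all_someP (T : Type) (n : nat) (v : n.-tuple (option T))
    (w : n.-tuple T) :
  all_some v = Some w <-> forall i, tnth v i = Some (tnth w i).
Proof.
split.
- rewrite /all_some; case: insubP => // u _ uE [uw] i; subst u.
  have sz : size (pmap id v) = size v by rewrite -uE !size_tuple.
  have vE : tval v = map some (tval w).
    rewrite uE; elim: (tval v) sz => //= -[x|] s IH /=.
      by case=> /IH {1}->.
    by move=> sz; have := size_pmap id s; rewrite sz => e;
       have := count_size (fun x : option T => x) s; rewrite -e ltnn.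
  pose x0 := tnth w i.
  by rewrite (tnth_nth (Some x0)) vE (nth_map x0) ?size_tuple // -tnth_nth.
- move=> vw.
  have -> : v = map_tuple some w by apply: eq_from_tnth => i; rewrite tnth_map.
  rewrite /all_some /=.
  have -> : pmap id (map some w) = w by elim: (tval w) => //= x s ->.
  by rewrite valK.
Qed.

Lemma all_some_None (T : Type) (n : nat) (v : n.-tuple (option T)) :
  all_some v = None <-> exists i, tnth v i = None.
Proof.
split=> [vN|[i vi]]; last first.
  by case E: (all_some v) => [w|] //; move/all_someP/(_ i): E; rewrite vi.
apply: contrapT => nex.
have vS i : {x | tnth v i = Some x}.
  by case E: (tnth v i) => [x|]; [exists x | case: nex; exists i].
have : all_some v = Some [tuple projT1 (vS i) | i < n].
  by apply/all_someP => i; rewrite tnth_mktuple; exact: projT2 (vS i).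
by rewrite vN.
Qed.

Record menger2 (n : nat) := Menger2 {
  carrier :> Type;
  mop : carrier -> n.-tuple carrier -> carrier;
  bop : 'I_n -> carrier -> carrier -> carrier;
  bopA : forall i, associative (bop i);
  mopA : forall x (y z : n.-tuple carrier),
    mop (mop x y) z = mop x [tuple mop (tnth y i) z | i < n]
}.

Definition isomorphic (n : nat) (G H : menger2 n) : Prop :=
  exists h : G -> H,
    [/\ bijective h,
        forall x (y : n.-tuple G), h (mop x y) = mop (h x) (map_tuple h y) &
        forall i x y, h (bop i x y) = bop i (h x) (h y)].

(* Partial [n]-place functions on [A]; [None] stands for "undefined". *)
Definition pfun (n : nat) (A : Type) : Type := n.-tuple A -> option A.

Definition pfun_mop (n : nat) (A : Type) (f : pfun n A)
    (g : n.-tuple (pfun n A)) : pfun n A :=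
  fun a => obind f (all_some [tuple tnth g i a | i < n]).

Definition pfun_bop (n : nat) (A : Type) (i : 'I_n) (f g : pfun n A) :
    pfun n A :=
  fun a => obind (fun b => f (tset a i b)) (g a).

Lemma pfun_bopA (n : nat) (A : Type) (i : 'I_n) :
  associative (@pfun_bop n A i).
Proof.
move=> f g h; apply/funext => a; rewrite /pfun_bop.
case: (h a) => //= c; case: (g _) => //= b; congr (f _).
apply: eq_from_tnth => j; rewrite !tnth_mktuple.
by case: eqP.
Qed.

Lemma pfun_mopA (n : nat) (A : Type) (f : pfun n A)
    (g h : n.-tuple (pfun n A)) :
  pfun_mop (pfun_mop f g) h =
  pfun_mop f [tuple pfun_mop (tnth g i) h | i < n].
Proof.
apply/funext => a; rewrite {1 3}/pfun_mop.
case E: (all_some [tuple tnth h i a | i < n]) => [b|] /=.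
  rewrite /pfun_mop; congr (obind f (all_some _)).
  by apply: eq_from_tnth => i; rewrite !tnth_mktuple E.
have /all_some_None[i _] := E.
suff /all_some_None -> :
  exists j, tnth [tuple tnth [tuple pfun_mop (tnth g k) h | k < n] j a
                 | j < n] j = None by [].
by exists i; rewrite !tnth_mktuple /pfun_mop E.
Qed.

Definition pfun_closed (n : nat) (A : Type) (Phi : set (pfun n A)) : Prop :=
  (forall f (g : n.-tuple (pfun n A)),
     Phi f -> (forall i, Phi (tnth g i)) -> Phi (pfun_mop f g)) /\
  (forall i f g, Phi f -> Phi g -> Phi (pfun_bop i f g)).

Section FunctionSystem.
Variables (n : nat) (A : Type) (Phi : set (pfun n A)).
Hypothesis closedPhi : pfun_closed Phi.

Fact fun_mop_subproof (f : Phi) (g : n.-tuple Phi) :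
  pfun_mop (val f) (map_tuple val g) \in Phi.
Proof.
apply/mem_set/(proj1 closedPhi); first exact: set_mem (valP f).
by move=> i; rewrite tnth_map; exact: set_mem (valP _).
Qed.

Fact fun_bop_subproof (i : 'I_n) (f g : Phi) :
  pfun_bop i (val f) (val g) \in Phi.
Proof.
by apply/mem_set/(proj2 closedPhi); [exact: set_mem (valP f)|
                                     exact: set_mem (valP g)].
Qed.

Definition fun_mop (f : Phi) (g : n.-tuple Phi) : Phi :=
  exist (fun h => h \in Phi) _ (fun_mop_subproof f g).

Definition fun_bop (i : 'I_n) (f g : Phi) : Phi :=
  exist (fun h => h \in Phi) _ (fun_bop_subproof i f g).

Fact fun_bopA i : associative (fun_bop i).
Proof. by move=> f g h; apply: val_inj; exact: pfun_bopA. Qed.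

Fact fun_mopA (f : Phi) (g h : n.-tuple Phi) :
  fun_mop (fun_mop f g) h = fun_mop f [tuple fun_mop (tnth g i) h | i < n].
Proof.
apply: val_inj => /=; rewrite pfun_mopA; congr pfun_mop.
by apply: eq_from_tnth => i; rewrite !tnth_map tnth_ord_tuple.
Qed.

Definition fun_menger2 : menger2 n := Menger2 fun_bopA fun_mopA.

End FunctionSystem.

(* A formal string is the list of its pairs (index, element), read from left
   to right; [bopw x s] is the left-bracketed product of [x] with [s]. *)
Definition bopw (n : nat) (G : menger2 n) (x : G) (s : seq ('I_n * G)) : G :=
  foldl (fun y p => bop p.1 y p.2) x s.

(* [None] is the empty symbol. *)
Fixpoint mu (n : nat) (G : menger2 n) (i : 'I_n) (s : seq ('I_n * G)) :
    option G :=
  if s is (j, x) :: s' then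
    if j == i then Some (bopw x s') else mu i s'
  else None.

(* Main.v *)
(** Necessity: by induction on the string [s], the product [bopw f s] of partial
    functions maps [a] to [f b], where [b_i] is the value at [a] of [mu i s], or
    [a_i] if [mu i s] is empty.  Sufficiency: let [g] act on [n]-tuples over [G]
    extended by one point, read as "empty", mapping a tuple [w] of elements of
    [G] to [mop g w] and the tuple of the [mu i s] to [bopw g s].  The last two
    conditions make this well defined, and [g] is its value at the all-empty
    tuple (take [s] empty), so the representation is faithful. *)

Require Import Defs.
From mathcomp Require Import all_boot.
From mathcomp Require Import boolp classical_sets.

Set Implicit Arguments.
Unset Strict Implicit.
Unset Printing Implicit Defensive.

Lemma tnth_tset (T : Type) (n : nat) (a : n.-tuple T) (i j : 'I_n) (b : T) :
  tnth (tset a i b) j = if j == i then b else tnth a j.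
Proof. by rewrite tnth_mktuple. Qed.

(** Overwriting entry [i] cannot hide an undefined entry of [v]: the new entry is computed from all
    of [v], so it is then undefined itself. *)
Lemma all_some_tset (T : Type) (n : nat) (v : n.-tuple (option T)) (i : 'I_n)
    (f : n.-tuple T -> option T) :
  all_some (tset v i (obind f (all_some v))) =
  obind (fun w => omap (tset w i) (f w)) (all_some v).
Proof.
case E: (all_some v) => [w|] /=; last first.
  by apply/all_some_None; exists i; rewrite tnth_tset eqxx.
case F: (f w) => [b|] /=; last first.
  by apply/all_some_None; exists i; rewrite tnth_tset eqxx.
apply/all_someP => j; rewrite !tnth_tset; case: eqP => // _.
by move/all_someP: E => ->.
Qed.

Definition faithful_rep (n : nat) (G : menger2 n) (A : Type)
    (phi : G -> pfun n A) : Prop :=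
  [/\ injective phi,
      forall x (y : n.-tuple G),
        phi (mop x y) = pfun_mop (phi x) (map_tuple phi y) &
      forall i x y, phi (bop i x y) = pfun_bop i (phi x) (phi y)].

(** The image of a faithful representation is closed under the operations, so subsets of functions
    need not be handled below. *)
Lemma isomorphic_pfunP (n : nat) (G : menger2 n) :
  (exists (A : Type) (Phi : set (pfun n A)) (closedPhi : pfun_closed Phi),
     isomorphic G (fun_menger2 closedPhi)) <->
  exists (A : Type) (phi : G -> pfun n A), faithful_rep phi.
Proof.
split=> [[A [Phi [cl [h [hbij hm hb]]]]]|[A [phi [phi_inj phim phib]]]].
  exists A, (fun x => val (h x)); split=> [x y /val_inj|x y|i x y].
  - exact: bij_inj.
  - rewrite hm /=; congr pfun_mop.
    by apply: eq_from_tnth => i; rewrite !tnth_map.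
  - by rewrite hb.
pose Phi : set (pfun n A) := [set f | exists x, phi x = f]%classic.
have inv f : Phi f -> {x | phi x = f} by move=> /cid.
have cl : pfun_closed Phi.
  split=> [f g [x <-] gP|i f g [x <-] [y <-]]; last first.
    by exists (bop i x y); rewrite phib.
  exists (mop x [tuple projT1 (inv _ (gP i)) | i < n]).
  rewrite phim; congr pfun_mop; apply: eq_from_tnth => i.
  by rewrite tnth_map tnth_mktuple; exact: projT2 (inv _ (gP i)).
have phiP x : phi x \in Phi by apply: mem_set; exists x.
exists A, Phi, cl.
pose h x : fun_menger2 cl := exist (fun f => f \in Phi) (phi x) (phiP x).
exists h; split=> [|x y|i x y].
- pose k (f : fun_menger2 cl) : G := projT1 (inv _ (set_mem (valP f))).
  have kK f : phi (k f) = val f by exact: projT2 (inv _ (set_mem (valP f))).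
  exists k => x; last by apply: val_inj; exact: kK.
  by apply: phi_inj; rewrite kK.
- apply: val_inj; rewrite /= phim; congr pfun_mop.
  by apply: eq_from_tnth => i; rewrite !tnth_map.
- by apply: val_inj; rewrite /= phib.
Qed.

Lemma mu_neq_None (n : nat) (G : menger2 n) (i : 'I_n) (s : seq ('I_n * G)) :
  i \in unzip1 s -> mu i s <> None.
Proof.
elim: s => //= -[j x] s IH; rewrite inE eq_sym.
by case: (j == i).
Qed.

Section Necessity.
Variables (n : nat) (n_gt0 : 0 < n) (G : menger2 n) (A : Type).
Variable phi : G -> pfun n A.
Hypothesis phi_rep : faithful_rep phi.

Lemma rep_mop x (y : n.-tuple G) a :
  phi (mop x y) a = obind (phi x) (all_some [tuple phi (tnth y i) a | i < n]).
Proof.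
case: phi_rep => _ -> _; rewrite /pfun_mop; congr (obind _ (all_some _)).
by apply: eq_from_tnth => i; rewrite !tnth_mktuple tnth_map.
Qed.

Lemma rep_bop i x y a :
  phi (bop i x y) a = obind (fun b => phi x (tset a i b)) (phi y a).
Proof. by case: phi_rep => _ _ ->. Qed.

Definition mu_val (s : seq ('I_n * G)) (a : n.-tuple A) : n.-tuple (option A) :=
  [tuple if mu i s is Some x then phi x a else Some (tnth a i) | i < n].

Lemma rep_bopw x s a : phi (bopw x s) a = obind (phi x) (all_some (mu_val s a)).
Proof.
elim: s x => [|[j y] s IH] x.
  have -> // : all_some (mu_val [::] a) = Some a.
  by apply/all_someP => i; rewrite tnth_mktuple.
(* A new first pair changes only the symbol of index [j], which becomes [bopw y s]; the induction
   hypothesis evaluates it at [a]. *)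
have -> : mu_val ((j, y) :: s) a =
    tset (mu_val s a) j (obind (phi y) (all_some (mu_val s a))).
  apply: eq_from_tnth => i; rewrite tnth_tset !tnth_mktuple /= eq_sym.
  by case: eqP => // _; rewrite IH.
rewrite all_some_tset [bopw _ _]/= -/(bopw _ _) IH.
case: (all_some _) => //= b; rewrite rep_bop.
by case: (phi y b).
Qed.

Lemma rep_mop_bop i x y (z : n.-tuple G) :
  mop (bop i x y) z = mop x (tset z i (mop y z)).
Proof.
case: (phi_rep) => phi_inj _ _; apply/phi_inj/funext => a; rewrite !rep_mop.
have -> : [tuple phi (tnth (tset z i (mop y z)) j) a | j < n] =
    tset [tuple phi (tnth z j) a | j < n] i
      (obind (phi y) (all_some [tuple phi (tnth z j) a | j < n])).
  apply: eq_from_tnth => j; rewrite tnth_tset !tnth_mktuple.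
  by case: eqP => // _; rewrite rep_mop.
rewrite all_some_tset; case: (all_some _) => //= b; rewrite rep_bop.
by case: (phi y b).
Qed.

Lemma rep_bop_mop i x z (y : n.-tuple G) :
  bop i (mop x y) z = mop x [tuple bop i (tnth y j) z | j < n].
Proof.
case: (phi_rep) => phi_inj _ _; apply/phi_inj/funext => a.
rewrite rep_bop rep_mop.
have -> : [tuple phi (tnth [tuple bop i (tnth y j) z | j < n] k) a | k < n] =
    [tuple obind (fun b => phi (tnth y k) (tset a i b)) (phi z a) | k < n].
  by apply: eq_from_tnth => k; rewrite !tnth_mktuple rep_bop.
case: (phi z a) => [b|] /=; first by rewrite rep_mop.
(* Where [z] is undefined the left side is undefined; so is the right side, because it has at least
   one argument. *)
suff /all_some_None -> :
  exists k, tnth [tuple (@None A) | _ < n] k = None by [].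
by exists (Ordinal n_gt0); rewrite tnth_mktuple.
Qed.

(** As every index occurs, no coordinate of the point [a] survives in [mu_val s a], which is then
    the tuple of the values at [a] of the symbols. *)
Lemma rep_bopw_full (x : G) (s : seq ('I_n * G)) :
  (forall i : 'I_n, i \in unzip1 s) ->
  Some (bopw x s) = omap (mop x) (all_some [tuple mu i s | i < n]).
Proof.
move=> sfull; case E: (all_some _) => [w|] /=; last first.
  have /all_some_None[i] := E; rewrite tnth_mktuple.
  by move=> /mu_neq_None; rewrite sfull; case.
move/all_someP: E => wE; congr Some.
case: (phi_rep) => phi_inj _ _; apply/phi_inj/funext => a.
rewrite rep_bopw rep_mop; congr (obind _ (all_some _)).
apply: eq_from_tnth => i; move: (wE i); rewrite !tnth_mktuple.
by move=> ->.
Qed.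

Lemma rep_bopw_eq (g : G) (s t : seq ('I_n * G)) :
  (forall i : 'I_n, mu i s = mu i t) -> bopw g s = bopw g t.
Proof.
move=> st; case: (phi_rep) => phi_inj _ _; apply/phi_inj/funext => a.
rewrite !rep_bopw; congr (obind _ (all_some _)).
by apply: eq_from_tnth => i; rewrite !tnth_mktuple st.
Qed.

End Necessity.

Section Sufficiency.
Variables (n : nat) (n_gt0 : 0 < n) (G : menger2 n).
Hypothesis mop_bop : forall (i : 'I_n) (x y : G) (z : n.-tuple G),
  mop (bop i x y) z = mop x (tset z i (mop y z)).
Hypothesis bop_mop : forall (i : 'I_n) (x z : G) (y : n.-tuple G),
  bop i (mop x y) z = mop x [tuple bop i (tnth y j) z | j < n].
Hypothesis bopw_full : forall (x : G) (s : seq ('I_n * G)),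
  (forall i : 'I_n, i \in unzip1 s) ->
  Some (bopw x s) = omap (mop x) (all_some [tuple mu i s | i < n]).
Hypothesis bopw_eq : forall (g : G) (s t : seq ('I_n * G)),
  (forall i : 'I_n, mu i s = mu i t) -> bopw g s = bopw g t.

Lemma bopw_mop x (y : n.-tuple G) s :
  bopw (mop x y) s = mop x [tuple bopw (tnth y i) s | i < n].
Proof.
elim: s y => [|[j z] s IH] y.
  by congr mop; apply: eq_from_tnth => i; rewrite tnth_mktuple.
rewrite [LHS]/= bop_mop -/(bopw _ s) IH; congr mop.
by apply: eq_from_tnth => i; rewrite !tnth_mktuple.
Qed.

Lemma mem_unzip1_mu (i : 'I_n) (s : seq ('I_n * G)) x :
  mu i s = Some x -> i \in unzip1 s.
Proof.
elim: s => //= -[j y] s IH; rewrite inE eq_sym.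
by case: (i == j).
Qed.

Definition is_mu (a : n.-tuple (option G)) (s : seq ('I_n * G)) : Prop :=
  forall i, tnth a i = mu i s.

(** The outer option marks undefinedness; the inner one adjoins the point read as the empty symbol,
    which is never a value. The string is chosen arbitrarily among those with symbols [a]. *)
Definition regular_rep (g : G) : pfun n (option G) := fun a =>
  if all_some a is Some w then Some (Some (mop g w))
  else if pselect (exists s, is_mu a s) is left ex
  then Some (Some (bopw g (projT1 (cid ex)))) else None.

Lemma regular_rep_some g a w :
  all_some a = Some w -> regular_rep g a = Some (Some (mop g w)).
Proof. by rewrite /regular_rep => ->. Qed.

(** If no symbol is empty, every index occurs in [s] and [bopw_full] makes the two clauses agree;
    otherwise [bopw_eq] makes the chosen string irrelevant. *)
Lemma regular_rep_mu g a s :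
  is_mu a s -> regular_rep g a = Some (Some (bopw g s)).
Proof.
move=> aE; rewrite /regular_rep; case E: (all_some a) => [w|].
  have sfull i : i \in unzip1 s.
    by move/all_someP: E => /(_ i); rewrite aE; exact: mem_unzip1_mu.
  rewrite bopw_full // (_ : [tuple mu i s | i < n] = a) ?E //.
  by apply: eq_from_tnth => i; rewrite tnth_mktuple.
case: pselect => [ex|[]]; last by exists s.
congr (Some (Some _)); case: cid => t /= tE.
by apply: bopw_eq => i; rewrite -aE tE.
Qed.

(** The first two cases may overlap. The third is uniform in [g] since all the functions share one
    domain. *)
Variant regular_rep_spec (a : n.-tuple (option G)) : Prop :=
| RegularSome w of all_some a = Some w
| RegularMu s of is_mu a s
| RegularNone of forall g, regular_rep g a = None.

Lemma regular_repP a : regular_rep_spec a.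
Proof.
case E: (all_some a) => [w|]; first exact: RegularSome E.
have [[s sE]|nex] := pselect (exists s, is_mu a s); first exact: RegularMu sE.
by apply: RegularNone => g; rewrite /regular_rep E; case: pselect.
Qed.

Lemma regular_rep_faithful : faithful_rep regular_rep.
Proof.
split=> [x y xy|x y|i x y].
- have e : is_mu (nseq_tuple n None) [::] by move=> i; rewrite tnth_nseq.
  move/(congr1 (@^~ (nseq_tuple n None))): xy.
  by rewrite !(regular_rep_mu _ e) => -[].
- apply/funext => a; rewrite /pfun_mop.
  (* The values of the inner functions are elements of [G], so the outer function is always
     evaluated by its first clause. *)
  have value (v : n.-tuple G) :
      (forall i, regular_rep (tnth y i) a = Some (Some (tnth v i))) ->
      obind (regular_rep x) (all_some
        [tuple tnth (map_tuple regular_rep y) i a | i < n]) =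
      Some (Some (mop x v)).
    move=> yv; have /all_someP -> /= : forall i,
        tnth [tuple tnth (map_tuple regular_rep y) i a | i < n] i =
        Some (tnth (map_tuple some v) i).
      by move=> i; rewrite tnth_mktuple !tnth_map yv.
    by apply/regular_rep_some/all_someP => i; rewrite tnth_map.
  case: (regular_repP a) => [w aw|s as_|aN].
  + rewrite (regular_rep_some _ aw) mopA.
    rewrite (value [tuple mop (tnth y i) w | i < n]) //.
    by move=> i; rewrite (regular_rep_some _ aw) tnth_mktuple.
  + rewrite (regular_rep_mu _ as_) bopw_mop.
    rewrite (value [tuple bopw (tnth y i) s | i < n]) //.
    by move=> i; rewrite (regular_rep_mu _ as_) tnth_mktuple.
  (* Outside the common domain the composite is undefined, as it has an inner function of index
     0. *)
  + rewrite aN; case E: (all_some _) => [v|] //.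
    move/all_someP/(_ (Ordinal n_gt0)): E.
    by rewrite tnth_mktuple tnth_map aN.
- apply/funext => a; rewrite /pfun_bop.
  case: (regular_repP a) => [w aw|s as_|aN]; last by rewrite !aN.
  + rewrite !(regular_rep_some _ aw) /= mop_bop; symmetry.
    apply/regular_rep_some/all_someP => j; rewrite !tnth_tset.
    by case: eqP => // _; move/all_someP: aw.
  + rewrite !(regular_rep_mu _ as_) /=; symmetry.
    (* Putting [bopw y s] in entry [i] gives the symbols of the string with [(i, y)] prefixed, and
       [bopw x ((i, y) :: s)] is [bopw (bop i x y) s] by computation. *)
    apply: (@regular_rep_mu _ _ ((i, y) :: s)) => j.
    by rewrite tnth_tset /= eq_sym as_; case: eqP.
Qed.

End Sufficiency.

Theorem theorem2 (n : nat) (n_gt0 : 0 < n) (G : menger2 n) :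
  (exists (A : Type) (Phi : set (pfun n A)) (closedPhi : pfun_closed Phi),
     isomorphic G (fun_menger2 closedPhi))
  <->
  [/\ forall (i : 'I_n) (x y : G) (z : n.-tuple G),
        mop (bop i x y) z = mop x (tset z i (mop y z)),
      forall (i : 'I_n) (x z : G) (y : n.-tuple G),
        bop i (mop x y) z = mop x [tuple bop i (tnth y j) z | j < n],
      forall (x : G) (s : seq ('I_n * G)),
        (forall i : 'I_n, i \in unzip1 s) ->
        Some (bopw x s) = omap (mop x) (all_some [tuple mu i s | i < n]) &
      forall (g : G) (s t : seq ('I_n * G)),
        (forall i : 'I_n, mu i s = mu i t) -> bopw g s = bopw g t].
Proof.
rewrite isomorphic_pfunP.
split=> [[A [phi phi_rep]]|[mop_bop bop_mop full eqw]].
  split.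
  - exact: rep_mop_bop phi_rep.
  - exact (rep_bop_mop n_gt0 phi_rep).
  - exact: rep_bopw_full phi_rep.
  - exact: rep_bopw_eq phi_rep.
by exists (option G), (@regular_rep n G); exact: regular_rep_faithful.
Qed.
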